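(* For any positive integers $m$ and $s$ and any nonempty set $K$, there exist a positive integer $n$ and an $\mathcal{S}_n$-invariant subset $V\subseteq K^{n}$ with $|V|=s$ such that, with $\mathcal{X}$ the set of $m\times n$ matrices over $K$ all of whose rows belong to $V$, \[ s^{m}=\sum_{[A]_{\mathrm{c}}\in \mathcal{X}/\overset{\mathrm{c}}{\sim}}\binom{n}{\operatorname{Mult}(\operatorname{col}(A))}, \] where the sum runs over the equivalence classes of $\overset{\mathrm{c}}{\sim}$ on $\mathcal{X}$ and $A$ is a representative of the class $[A]_{\mathrm{c}}$.
   Context: $\mathcal{S}_n$ is the symmetric group on $\{1,\ldots,n\}$. A finite set $V\subseteq K^n$ is $\mathcal{S}_n$-invariant if $\mathcal{S}_nV=V$, where $\mathcal{S}_nV=\{(r_{\sigma(1)},\ldots,r_{\sigma(n)}) : (r_1,\ldots,r_n)\in V,\ \sigma\in\mathcal{S}_n\}$. Given $m,n,K,V$, the set $\mathcal{X}$ consists of all $m\times n$ matrices with entries in $K$ whose rows $\boldsymbol{r}_1,\ldots,\boldsymbol{r}_m$ all lie in $V$. For a multiset $S$, $\operatorname{supp}(S)$ is the set of its distinct elements, $\operatorname{mult}_S(a)$ is the multiplicity of $a$ in $S$, and $\operatorname{Mult}(S)$ is the multiset $\{\operatorname{mult}_S(a) : a\in\operatorname{supp}(S)\}$, which has cardinality $|\operatorname{supp}(S)|$. For a positive integer $N$ and a multiset $S=\{r_1,\ldots,r_q\}$ of nonnegative integers (cardinality $q$ counted with multiplicity), $\binom{N}{S}:=\frac{N!}{r_1!\cdots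 r_q!}$ if $r_1+\cdots+r_q=N$, and $\binom{N}{S}:=0$ otherwise. For a matrix $A$ with columns $\boldsymbol{c}_1,\ldots,\boldsymbol{c}_n$, $\operatorname{col}(A)$ is the multiset $\{\boldsymbol{c}_1,\ldots,\boldsymbol{c}_n\}$. For $A,B\in\mathcal{X}$, $A\overset{\mathrm{c}}{\sim}B$ means $\operatorname{col}(A)=\operatorname{col}(B)$; this is an equivalence relation on $\mathcal{X}$, $\mathcal{X}/\overset{\mathrm{c}}{\sim}$ is the set of its equivalence classes, and $[A]_{\mathrm{c}}$ is the class of $A$.
   Formalization: The formal theorem assumes that K has at least two distinct elements when s > 1; otherwise, for one-element K, each K^n is a singleton and has no subset V with |V| = s ≥ 2, so the claim as stated fails. *)

(* Defs.v *)
From HB Require Import structures.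
From mathcomp Require Import all_boot all_algebra all_fingroup.
From mathcomp Require Import finmap multiset.
From mathcomp Require Import boolp.

Set Implicit Arguments.
Unset Strict Implicit.
Unset Printing Implicit Defensive.

Local Open Scope fset_scope.
Local Open Scope mset_scope.
Local Open Scope nat_scope.

(* [Mult S] has one entry for each element of the support of [S], so equal
   multiplicities are repeated. *)
Definition Mult (T : choiceType) (S : {mset T}) : {mset nat} :=
  seq_mset [seq S a | a <- finsupp S].

(* Iteration over a multiset counts each element with its multiplicity.
   The quotient is exact, see [multinomial_exact]. *)
Definition multinomial (N : nat) (S : {mset nat}) : nat :=
  if \sum_(r <- S) r == N then N`! %/ \prod_(r <- S) r`! else 0.

Lemma multinomial_exact (N : nat) (S : {mset nat}) :
  \sum_(r <- S) r = N -> multinomial N S * \prod_(r <- S) r`! = N`!.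
Proof.
move=> <-; rewrite /multinomial eqxx divnK //.
elim: (enum_mset S) => [|r s IHs]; first by rewrite !big_nil.
rewrite !big_cons -(bin_fact (leq_addr (\sum_(j <- s) j) r)) addKn.
by apply: dvdn_mull; apply: dvdn_mul.
Qed.

Section Matrices.
Variable K : choiceType.

(* [col_perm sigma r] has entry [r 0 (sigma j)] in column [j]. *)
Definition Sn_orbit n (V : {fset 'rV[K]_n}) : {fset 'rV[K]_n} :=
  [fset col_perm sigma r | r in V, sigma in [set: 'S_n]].

Definition Sn_invariant n (V : {fset 'rV[K]_n}) : Prop := Sn_orbit V = V.

(* Each choice of [m] elements of [V] is stacked into a matrix; this encoding
   makes the set of matrices finite although [K] need not be. *)
Definition matrices_over m n (V : {fset 'rV[K]_n}) : {fset 'M[K]_(m, n)} :=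
  [fset (\matrix_(i < m) val ((f : {ffun 'I_m -> V}) i))%R
  | f in [set: {ffun 'I_m -> V}]].

Lemma matrices_overP m n (V : {fset 'rV[K]_n}) (A : 'M[K]_(m, n)) :
  reflect (forall i, row i A \in V) (A \in matrices_over m V).
Proof.
apply: (iffP (imfsetP _ _ _ _)) => [[f _ ->] i | AV]; first by rewrite rowK; apply: valP.
exists [ffun i => [` AV i]]; first by rewrite inE.
by apply/row_matrixP => i; rewrite rowK ffunE.
Qed.

Definition columns m n (A : 'M[K]_(m, n)) : {mset 'cV[K]_m} :=
  seq_mset [seq col j A | j <- enum 'I_n].

Definition col_equiv m n (V : {fset 'rV[K]_n}) : rel (matrices_over m V) :=
  fun A B => columns (val A) == columns (val B).

Lemma col_equiv_rel m n (V : {fset 'rV[K]_n}) :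
  equivalence_rel (@col_equiv m n V).
Proof.
by move=> A B C; rewrite /col_equiv eqxx; split=> // /eqP ->.
Qed.

Definition col_classes m n (V : {fset 'rV[K]_n}) :
    {set {set matrices_over m V}} :=
  equivalence_partition (@col_equiv m n V) [set: matrices_over m V].

End Matrices.

(* Main.v *)
Require Import Defs.
From HB Require Import structures.
From mathcomp Require Import all_boot all_algebra all_fingroup.
From mathcomp Require Import finmap multiset.
From mathcomp Require Import boolp.

(** The identity holds for every $\mathcal S_n$-invariant $V$ and is a count
of the $m \times n$ matrices with rows in $V$. Choosing the rows one at a time
gives $|V|^m$ such matrices ([card_matrices_over]). Grouping them by their
multiset of columns gives the sum: permuting the columns of a matrix permutes
the entries of each row, so the invariance of $V$ keeps every rearrangement of
the columns of $A$ inside the set, and the class of $A$ is in bijection with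
the distinct rearrangements of its sequence of columns ([card_col_class]).
A sequence of length $n$ has as many distinct rearrangements as the
multinomial coefficient of its multiplicities ([multinomial_Mult]), by an
induction on the first entry of the rearrangement
([size_permutations_counts]).

It remains to find an invariant $V$ of size $s$. For $x \neq y$ in $K$, the
$s$ rows of length $s$ with entry $y$ at one place and $x$ elsewhere form one
([spikes]); for $s = 1$ this is a single row of length $1$, and $x = y$ is
harmless. *)

Local Open Scope nat_scope.

Lemma sum_count_mem_undup (T : eqType) (s : seq T) :
  \sum_(x <- undup s) count_mem x s = size s.
Proof.
rewrite -sum1_size -[RHS]big_undup_iterop_count.
apply: eq_bigr => x _; case: (count_mem x s) => // k.
by rewrite iteropS; elim: k => //= k <-.
Qed.

(** Rearrangements of [s] starting with [x] are the rearrangements of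
[rem x s], and removing [x] divides the product of the factorials of the
multiplicities by the multiplicity of [x]. So the induction hypothesis turns
the left-hand side into the sum over [x] of the multiplicity of [x] times
[(size s).-1`!]. The product ranges over an arbitrary [u] containing [s]
because the support of [rem x s] may be smaller than that of [s], whereas the
same [u] serves for both. *)
Lemma size_permutations_counts (T : eqType) (s u : seq T) :
  uniq u -> {subset s <= u} ->
  size (permutations s) * \prod_(a <- u) (count_mem a s)`! = (size s)`!.
Proof.
move=> uniq_u; have [n] := ubnP (size s).
elim: n s => // n IHn s le_s_n sub_su.
have [-> | nt_s] := eqVneq s [::].
  by rewrite /= big1 ?muln1.
rewrite (perm_size (permutationsE _)) ?lt0n ?size_eq0 // size_allpairs_dep.
rewrite sumnE big_map big_distrl /=.
rewrite (eq_big_seq (fun x => count_mem x s * (size s).-1`!)).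
  rewrite -big_distrl /= sum_count_mem_undup.
  by case: s nt_s {le_s_n sub_su} => // x s _; rewrite factS.
move=> x; rewrite mem_undup => s_x.
have count_s a : count_mem a s = (x == a) + count_mem a (rem x s).
  by rewrite (seq.permP (perm_to_rem s_x)).
rewrite -(size_rem s_x) -IHn; first last.
- by move=> y /mem_rem; apply: sub_su.
- rewrite size_rem // -ltnS (leq_trans _ le_s_n) // ltnS.
  by rewrite prednK //; case: s s_x {nt_s le_s_n sub_su count_s}.
rewrite mulnCA; congr (_ * _).
rewrite (bigD1_seq x) ?sub_su //= [in RHS](bigD1_seq x) ?sub_su //= mulnA.
congr (_ * _); first by rewrite count_s eqxx factS.
by apply: eq_bigr => a; rewrite count_s eq_sym => /negPf ->.
Qed.

Lemma big_Mult (R : Type) (idx : R) (op : Monoid.com_law idx) (F : nat -> R)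
    (T : choiceType) (s : seq T) :
  \big[op/idx]_(r <- Mult (seq_mset s)) F r =
  \big[op/idx]_(a <- undup s) F (count_mem a s).
Proof.
rewrite (perm_big _ (perm_eq_seq_mset _)) big_map.
rewrite (perm_big (undup s)) /=; last first.
  apply: uniq_perm; rewrite ?fset_uniq ?undup_uniq // => a.
  by rewrite mem_undup msuppE in_mset mset_seqE -has_count has_pred1.
by apply: eq_bigr => a _; rewrite mset_seqE.
Qed.

Lemma multinomial_Mult (T : choiceType) (s : seq T) :
  multinomial (size s) (Mult (seq_mset s)) = size (permutations s).
Proof.
have prod_gt0 : 0 < \prod_(r <- Mult (seq_mset s)) r`!.
  by rewrite prodn_gt0 // => r; apply: fact_gt0.
apply/eqP; rewrite -(eqn_pmul2r prod_gt0) multinomial_exact.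
  rewrite big_Mult size_permutations_counts ?undup_uniq // => x.
  by rewrite mem_undup.
by rewrite big_Mult sum_count_mem_undup.
Qed.

Definition colseq (K : choiceType) m n (A : 'M[K]_(m, n)) : seq 'cV[K]_m :=
  [seq col j A | j <- enum 'I_n].

Lemma size_colseq (K : choiceType) m n (A : 'M[K]_(m, n)) :
  size (colseq K m n A) = n.
Proof. by rewrite size_map -cardE card_ord. Qed.

Lemma colseq_inj (K : choiceType) m n : injective (colseq K m n).
Proof.
move=> A B /eq_in_map eqAB; apply/matrixP => i j.
by have /matrixP/(_ i 0%R) := eqAB j (mem_enum _ j); rewrite !mxE.
Qed.

Lemma perm_colseq (K : choiceType) m n (A : 'M[K]_(m, n)) (t : seq 'cV[K]_m) :
  perm_eq t (colseq K m n A) ->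
  exists sigma : 'S_n, t = colseq K m n (col_perm sigma A).
Proof.
have -> : colseq K m n A = [tuple col j A | j < n] by [].
case/tuple_permP => sigma ->; exists sigma.
apply: eq_map => j; rewrite tnth_mktuple.
by apply/matrixP => i k; rewrite !mxE.
Qed.

Lemma matrices_over_col_perm (K : choiceType) m n (V : {fset 'rV[K]_n})
    (sigma : 'S_n) (A : 'M[K]_(m, n)) :
  Sn_invariant V -> A \in matrices_over m V ->
  col_perm sigma A \in matrices_over m V.
Proof.
move=> V_inv /matrices_overP AV; apply/matrices_overP => i.
have -> : row i (col_perm sigma A) = col_perm sigma (row i A).
  by apply/rowP => j; rewrite !mxE.
rewrite -V_inv; apply/imfset2P.
by exists (row i A) => //; exists sigma; rewrite // inE.
Qed.

(** [colseq] maps the class of [A] injectively into the rearrangements of the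
columns of [A]; it is onto because the rearranged matrices still have their
rows in [V]. *)
Lemma card_col_class (K : choiceType) m n (V : {fset 'rV[K]_n})
    (A : matrices_over m V) :
  Sn_invariant V ->
  #|[set B | col_equiv A B]| = multinomial n (Mult (columns (val A))).
Proof.
move=> V_inv.
have := multinomial_Mult _ (colseq K m n (val A)); rewrite size_colseq => ->.
rewrite cardE -(size_map (fun B : matrices_over m V => colseq K m n (val B))).
apply/perm_size/uniq_perm; rewrite ?permutations_uniq //.
  by rewrite map_inj_uniq ?enum_uniq // => B C /colseq_inj /val_inj.
move=> t; rewrite mem_permutations; apply/mapP/idP => [[B]|].
  rewrite mem_enum inE => /eqP/eq_seq_msetP AB ->.
  by rewrite perm_sym.
move=> tA; have [sigma Dt] := perm_colseq _ _ _ _ _ tA.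
have XA := matrices_over_col_perm _ _ _ _ sigma _ V_inv (valP A).
exists [` XA]%fset => //.
rewrite mem_enum inE; apply/eqP/eq_seq_msetP.
by rewrite -[X in perm_eq _ X]Dt perm_sym.
Qed.

Lemma card_matrices_over (K : choiceType) m n (V : {fset 'rV[K]_n}) :
  #|{: matrices_over m V}| = #|` V| ^ m.
Proof.
rewrite -cardfE card_imfset /=; last first.
  move=> f g /matrixP eq_fg; apply/ffunP => i; apply/val_inj/rowP => j.
  by have := eq_fg i j; rewrite !mxE.
by rewrite -cardE cardsT card_ffun card_ord cardfE.
Qed.

Lemma card_matrices_over_classes (K : choiceType) m n (V : {fset 'rV[K]_n})
    (rep : {set matrices_over m V} -> matrices_over m V) :
  Sn_invariant V -> (forall C, C \in col_classes m V -> rep C \in C) ->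
  #|` V| ^ m = \sum_(C in col_classes m V)
                 multinomial n (Mult (columns (val (rep C)))).
Proof.
move=> V_inv repP; rewrite -card_matrices_over -cardsT.
have equivR : {in [set: matrices_over m V] & &,
    equivalence_rel (@col_equiv K m n V)}.
  by move=> A B C _ _ _; apply: col_equiv_rel.
rewrite (card_partition (equivalence_partitionP equivR)).
apply: eq_bigr => C PC; rewrite -card_col_class //; apply: eq_card => B.
(* The class [C] comes from some [A], which need not be its representative. *)
move: (rep C) (repP _ PC); case/imsetP: PC => A _ -> D.
rewrite !inE /= => /eqP AD.
by rewrite /col_equiv AD.
Qed.

Definition spike (K : choiceType) (x y : K) n (i : 'I_n) : 'rV[K]_n :=
  (\row_j if j == i then y else x)%R.

Definition spikes (K : choiceType) (x y : K) n : {fset 'rV[K]_n} :=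
  [fset spike K x y n i | i in 'I_n]%fset.

Lemma col_perm_spike (K : choiceType) (x y : K) n (sigma : 'S_n) (i : 'I_n) :
  col_perm sigma (spike K x y n i) = spike K x y n (sigma^-1%g i).
Proof.
by apply/rowP => j; rewrite !mxE -(inj_eq (@perm_inj _ sigma) j) permKV.
Qed.

Lemma spikes_invariant (K : choiceType) (x y : K) n :
  Sn_invariant (spikes K x y n).
Proof.
apply/fsetP => r; apply/imfset2P/imfsetP.
  case=> _ /imfsetP[i _ ->] [sigma _ ->].
  by exists (sigma^-1%g i); rewrite // col_perm_spike.
case=> i _ ->; exists (spike K x y n i); first by apply/imfsetP; exists i.
by exists 1%g; rewrite ?inE // col_perm_spike invg1 perm1.
Qed.

Lemma card_spikes (K : choiceType) (x y : K) n :
  (1 < n -> x <> y) -> #|` spikes K x y n| = n.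
Proof.
move=> neq_xy; rewrite card_imfset /= ?size_enum_ord // => i j.
move=> /rowP/(_ i); rewrite !mxE eqxx.
case: eqP => // neq_ij yx; case: neq_xy => //.
by case: n i j neq_ij {yx} => [|[|//]] i j; [case: i | rewrite !ord1].
Qed.

Theorem theorem2p1 (m s : nat) (K : Type) (hm : 0 < m) (hs : 0 < s)
    (hK : inhabited K)
    (hKs : 1 < s -> exists x y : K, x <> y) :
  exists (n : nat) (V : {fset 'rV[{classic K}]_n}),
    [/\ 0 < n, Sn_invariant V, #|` V| = s
      & forall rep : {set matrices_over m V} -> matrices_over m V,
          (forall C, C \in col_classes m V -> rep C \in C) ->
          s ^ m = \sum_(C in col_classes m V)
                    multinomial n (Mult (columns (val (rep C))))].
Proof.
have [x [y neq_xy]] : exists x y : {classic K}, 1 < s -> x <> y.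
  case: (ltnP 1 s) => [/hKs[x [y neq_xy]] | _]; first by exists x, y.
  by case: hK => x; exists x, x.
have card_s := card_spikes _ _ _ s neq_xy.
have V_inv := spikes_invariant _ x y s.
exists s, (spikes _ x y s); split=> // rep repP.
by rewrite -card_matrices_over_classes // card_s.
Qed.
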